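(* Let $\mathcal{A} = (Q, \delta, I, \delta_F)$ be a Büchi automaton over a finite nonempty alphabet $\Sigma$ such that every accepting SCC of $\mathcal{A}$ is an IADAC (initial almost deterministic accepting component). Let $\mathcal{B}$ be the deterministic automaton with state set $2^Q$, initial state $I$, transitions $R \xrightarrow{a} S$ for every $R \subseteq Q$ and $a \in \Sigma$ with $S = \bigcup_{r \in R} \delta(r,a)$, where such a transition is coloured (with the colour $0$) iff $\bigcup_{r \in R} \delta_F(r,a) \neq \emptyset$, and with acceptance condition $\mathrm{Fin}(0)$: a word $w \in \Sigma^\omega$ is accepted by $\mathcal{B}$ iff the unique run of $\mathcal{B}$ on $w$ from $I$ takes coloured transitions only finitely often. Then $L(\mathcal{A}) = \Sigma^\omega \setminus L(\mathcal{B})$.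
   Context: A Büchi automaton (BA) $\mathcal{A} = (Q, \delta, I, \delta_F)$ over $\Sigma$ has a finite state set $Q$, transitions $\delta \subseteq Q \times \Sigma \times Q$ (written $q \xrightarrow{a} r$), initial states $I \subseteq Q$, and accepting transitions $\delta_F \subseteq \delta$. Write $\delta(r,a) = \{p \mid r \xrightarrow{a} p \in \delta\}$ and $\delta_F(r,a) = \{p \mid r \xrightarrow{a} p \in \delta_F\}$. A run on $w = w_0w_1\dots \in \Sigma^\omega$ from $q$ is a sequence $\rho_0\rho_1\dots$ of states with $\rho_0 = q$ and $\rho_i \xrightarrow{w_i} \rho_{i+1} \in \delta$ for all $i$; it is accepting iff it uses transitions of $\delta_F$ infinitely often. $L(\mathcal{A})$ is the set of words having an accepting run from some initial state. A state is useless if no word is accepted from it. For $C \subseteq Q$, $\delta|_C = \{q \xrightarrow{a} r \in \delta \mid q, r \in C\}$. A strongly connected component (SCC) is a maximal nonempty set of states that are mutually reachable; an SCC is accepting if it contains at least one transition of $\delta_F$ (i.e., $\delta_F \cap \delta|_C \neq \emptyset$). Standing convention: every transition whose source and target lie in different SCCs is not in $\delta_F$. For an SCC $C$, let $\mathcal{B}_C$ be the BA obtained from $(Q, \delta, I, \delta_F \cap \delta|_C)$ by removing its useless states (and the transitions incident to them). $C$ is initial almost deterministic if for any two transitions $q \xrightarrow{a} p$ and $q \xrightarrow{a} r$ of $\mathcal{B}_C$ from the same state over the same symbol, either $p = r$ or neither $p$ nor $r$ lies in the same SCC as $q$. An IADAC is an accepting SCC that is initial almost deterministic. *)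

(* Defs.v *)
From mathcomp Require Import boolp classical_sets cardinality.
From mathcomp Require Import all_boot.

Set Implicit Arguments.
Unset Strict Implicit.
Unset Printing Implicit Defensive.

Section Buchi.
Variables (Sigma Q : finType).

Record buchi := Buchi {
  ba_trans : {set Q * Sigma * Q};
  ba_init : {set Q};
  ba_acc : {set Q * Sigma * Q};
  ba_acc_sub : ba_acc \subset ba_trans }.

Implicit Type A : buchi.

Definition ba_succ A (r : Q) (a : Sigma) : {set Q} :=
  [set p | (r, a, p) \in ba_trans A].

Definition ba_acc_succ A (r : Q) (a : Sigma) : {set Q} :=
  [set p | (r, a, p) \in ba_acc A].

Definition is_run A (w : nat -> Sigma) (q : Q) (rho : nat -> Q) : Prop :=
  rho 0 = q /\ forall i, (rho i, w i, rho i.+1) \in ba_trans A.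

Definition accepting_run A (w : nat -> Sigma) (rho : nat -> Q) : Prop :=
  infinite_set [set i | (rho i, w i, rho i.+1) \in ba_acc A]%classic.

Definition accepted_from A (q : Q) (w : nat -> Sigma) : Prop :=
  exists2 rho, is_run A w q rho & accepting_run A w rho.

Definition ba_lang A : set (nat -> Sigma) :=
  [set w | exists2 q, q \in ba_init A & accepted_from A q w]%classic.

Definition useless A (q : Q) : Prop := forall w, ~ accepted_from A q w.

Definition ba_step A : rel Q := fun q r => [exists a, (q, a, r) \in ba_trans A].

Definition mutually_reachable A (C : {set Q}) : bool :=
  [forall q in C, forall r in C, connect (ba_step A) q r].

Definition is_scc A (C : {set Q}) : Prop :=
  maxset (fun D : {set Q} => (D != set0) && mutually_reachable A D) C.

Definition same_scc A (q r : Q) : Prop :=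
  exists C : {set Q}, [/\ is_scc A C, q \in C & r \in C].

Definition trans_in A (C : {set Q}) : {set Q * Sigma * Q} :=
  [set t in ba_trans A | (t.1.1 \in C) && (t.2 \in C)].

Definition accepting_scc A (C : {set Q}) : Prop :=
  is_scc A C /\ ba_acc A :&: trans_in A C != set0.

Definition no_acc_between_sccs A : Prop :=
  forall (C D : {set Q}) q a r, is_scc A C -> is_scc A D -> C != D ->
    q \in C -> r \in D -> (q, a, r) \notin ba_acc A.

Lemma acc_inside_sub A (C : {set Q}) :
  ba_acc A :&: trans_in A C \subset ba_trans A.
Proof. exact: subset_trans (subsetIl _ _) (ba_acc_sub A). Qed.

Definition acc_inside A (C : {set Q}) : buchi :=
  @Buchi (ba_trans A) (ba_init A) _ (acc_inside_sub A C).

Definition useful_states A : {set Q} := [set q | ~~ `[< useless A q >]].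

End Buchi.

Section Restriction.
Variables (Sigma Q : finType) (A : buchi Sigma Q) (S : {set Q}).

Local Notation QS := {q : Q | q \in S}.

Definition pull_trans (T : {set Q * Sigma * Q}) : {set QS * Sigma * QS} :=
  [set t | (val t.1.1, t.1.2, val t.2) \in T].

Lemma pull_acc_sub : pull_trans (ba_acc A) \subset pull_trans (ba_trans A).
Proof.
by apply/subsetP => t; rewrite !inE; apply: (subsetP (ba_acc_sub A)).
Qed.

Definition restrict_states : buchi Sigma QS :=
  @Buchi Sigma _ (pull_trans (ba_trans A)) [set q | val q \in ba_init A]
    _ pull_acc_sub.

End Restriction.

Section IADAC.
Variables (Sigma Q : finType) (A : buchi Sigma Q) (C : {set Q}).

Definition component_ba :=
  restrict_states (acc_inside A C) (useful_states (acc_inside A C)).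

(* The SCCs are those of component_ba. Every state on a path between two useful
   states is useful, so they are the traces of the SCCs of A. *)
Definition initial_almost_deterministic : Prop :=
  forall q a p r,
    (q, a, p) \in ba_trans component_ba ->
    (q, a, r) \in ba_trans component_ba ->
    p = r \/ (~ same_scc component_ba q p /\ ~ same_scc component_ba q r).

Definition iadac : Prop :=
  accepting_scc A C /\ initial_almost_deterministic.

End IADAC.

(* Complete deterministic automata with acceptance condition Fin(0). The
   transition from s over a is determined by (s, a), so it is coloured by a
   predicate on that pair. *)
Record dfin (Sigma S : finType) := DFin {
  df_init : S;
  df_next : S -> Sigma -> S;
  df_coloured : S -> Sigma -> bool }.

Section DFin.
Variables (Sigma S : finType) (B : dfin Sigma S).

Fixpoint df_run (w : nat -> Sigma) (n : nat) : S :=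
  if n is n'.+1 then df_next B (df_run w n') (w n') else df_init B.

Definition df_lang : set (nat -> Sigma) :=
  [set w | finite_set [set i | df_coloured B (df_run w i) (w i)]]%classic.

End DFin.

Definition subset_dfin (Sigma Q : finType) (A : buchi Sigma Q) :
    dfin Sigma {set Q} :=
  {| df_init := ba_init A;
     df_next := fun R a => \bigcup_(r in R) ba_succ A r a;
     df_coloured := fun R a => \bigcup_(r in R) ba_acc_succ A r a != set0 |}.

(* Main.v *)
Require Import Defs.
From mathcomp Require Import boolp classical_sets cardinality.
From mathcomp Require Import all_boot.

Set Implicit Arguments.
Unset Strict Implicit.
Unset Printing Implicit Defensive.

(** An accepting run of [A] on [w] colours infinitely many transitions of the
subset automaton. Conversely, if infinitely many transitions
are coloured, some state [x] is, at infinitely many positions [i], reached on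
the prefix of length [i] and the source of an accepting transition over [w i].
Koenig's lemma produces an infinite run all of whose states can reach such
occurrences of [x] infinitely often. This run eventually stays inside one SCC
of the automaton [B_C], where [C] is the SCC of [x]; from then on, since [C] is
initial almost deterministic, it is the only run on the remaining word that can
still reach [C], so the accepting transitions at [x] are its own. *)

(** * Infinite sets of positions and finiteness arguments *)

Definition infinitely_often (P : nat -> Prop) : Prop :=
  forall m, exists2 k, m <= k & P k.

Lemma infinite_natP (P : nat -> Prop) :
  infinite_set [set i | P i]%classic <-> infinitely_often P.
Proof.
split=> [infP m | ioP /finite_seqP[s Ps]].
  apply: contrapT => noP; apply: infP; apply: sub_finite_set (finite_II m).
  move=> i Pi /=; rewrite ltnNge; apply/negP => le_mi.
  by apply: noP; exists i.
have [k lt_k Pk] := ioP (\max_(i <- s) i).+1.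
have /= k_s : [set` s]%classic k by rewrite -Ps.
by have := @leq_bigmax_seq _ s xpredT id k k_s isT; rewrite leqNgt lt_k.
Qed.

Lemma infinitely_often_pigeonhole (T : finType) (P : T -> nat -> Prop) :
  infinitely_often (fun k => exists p, P p k) ->
  exists p, infinitely_often (P p).
Proof.
move=> ioP; apply: contrapT => /forallNP noP.
have bnd p : exists m, forall k, m <= k -> ~ P p k.
  have /existsNP[m mP] := noP p; exists m => k le_mk Pk.
  by apply: mP; exists k.
have [b bP] := choice bnd.
have [k le_k [p]] := ioP (\max_p b p).
by apply: bP; apply: leq_trans (leq_bigmax p) le_k.
Qed.

(** The sets of points reachable from [rho n] decrease with [n], so their cardinalities reach a
    minimum. From then on consecutive sets coincide, and [rho n] lies in its own. *)
Lemma eventually_connect_back (T : finType) (e : rel T) (rho : nat -> T) :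
  (forall i, e (rho i) (rho i.+1)) ->
  exists N, forall n, N <= n -> connect e (rho n.+1) (rho n).
Proof.
move=> e_rho; pose f n := #|connect e (rho n)|.
have sub n : connect e (rho n.+1) \subset connect e (rho n).
  by apply/subsetP => y; apply: connect_trans; apply: connect1.
have f_anti : {homo f : m n / m <= n >-> n <= m}.
  apply: homo_leq => // [m n p|n]; first by move=> /[swap]; apply: leq_trans.
  exact: subset_leq_card.
have ex_f : exists c, `[< exists n, f n = c >].
  by exists (f 0); apply/asboolP; exists 0.
case: (ex_minnP ex_f) => c /asboolP[N fN] min_c.
exists N => n le_Nn; have fE : f n.+1 = f n.
  apply/eqP; rewrite eqn_leq f_anti //= (leq_trans (f_anti _ _ le_Nn)) // fN.
  by apply: min_c; apply/asboolP; exists n.+1.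
have /(_ (rho n)) := elimT (subset_cardP fE) (sub n).
by rewrite !inE connect0.
Qed.

(** * SCCs and useful states *)

Section Components.
Variables (Sigma Q : finType).
Implicit Types (A : buchi Sigma Q) (q r x y : Q).

Definition scc_of A q : {set Q} :=
  [set r | connect (ba_step A) q r && connect (ba_step A) r q].

Lemma mem_scc_of A q : q \in scc_of A q.
Proof. by rewrite inE connect0. Qed.

Lemma scc_of_is_scc A q : is_scc A (scc_of A q).
Proof.
apply/maxsetP; split=> [|D /andP[_ /forall_inP mutD] /subsetP subD].
  apply/andP; split; first by apply/set0Pn; exists q; apply: mem_scc_of.
  apply/forall_inP => r; rewrite inE => /andP[_ rq].
  apply/forall_inP => s; rewrite inE => /andP[qs _].
  exact: connect_trans rq qs.
have qD : q \in D by apply/subD/mem_scc_of.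
apply/eqP; rewrite eqEsubset; apply/andP; split; apply/subsetP => // r rD.
by rewrite inE (forall_inP (mutD _ qD)) ?(forall_inP (mutD _ rD)).
Qed.

Lemma connect_same_scc A q r :
  connect (ba_step A) q r -> connect (ba_step A) r q -> same_scc A q r.
Proof.
move=> qr rq; exists (scc_of A q); split; last by rewrite inE qr rq.
  exact: scc_of_is_scc.
exact: mem_scc_of.
Qed.

Lemma acc_scc_of A x a y :
  no_acc_between_sccs A -> (x, a, y) \in ba_acc A -> y \in scc_of A x.
Proof.
move=> conv acc; have [eqC|neqC] := eqVneq (scc_of A x) (scc_of A y).
  by rewrite eqC mem_scc_of.
have := conv _ _ x a y (scc_of_is_scc A x) (scc_of_is_scc A y) neqC.
by rewrite acc !mem_scc_of => /(_ isT isT).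
Qed.

Lemma ba_step_trans A q a r : (q, a, r) \in ba_trans A -> ba_step A q r.
Proof. by move=> tr; apply/existsP; exists a. Qed.

Lemma accepted_from_cons A q a r w :
  (q, a, r) \in ba_trans A -> accepted_from A r w ->
  accepted_from A q (fun i => if i is j.+1 then w j else a).
Proof.
move=> tr [rho [rho0 rho_tr] /infinite_natP acc].
exists (fun i => if i is j.+1 then rho j else q).
  by split=> // -[|i] //=; rewrite rho0.
apply/infinite_natP => m; have [k le_mk Pk] := acc m.
by exists k.+1; first exact: leqW.
Qed.

Lemma accepted_from_cycle A x a y :
  (x, a, y) \in ba_acc A -> connect (ba_step A) y x ->
  exists w, accepted_from A x w.
Proof.
move=> acc /connectP[s path_s last_s].
pose L := y :: s; pose n := size L; pose st j := nth x (x :: L) j.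
have tr_xy : (x, a, y) \in ba_trans A by apply: (subsetP (ba_acc_sub A)).
have path_L : path (ba_step A) x L by rewrite /= path_s (ba_step_trans tr_xy).
(* Beyond the cycle the letter [a] is a mere default that makes the labelling total. *)
have lab_ex j : exists b, j < n -> (st j, b, st j.+1) \in ba_trans A.
  case: (ltnP j n) => [lt_jn|_]; last by exists a.
  by have /existsP[b] := pathP x path_L j lt_jn; exists b.
have [lab labP] := choice lab_ex.
have st_n : st n = x by rewrite /st /n /= -last_nth.
(* The letter [a] is forced at the start of each period, since [lab 0] may label another,
   non-accepting transition from [x] to [y]. *)
pose w i := if i %% n == 0 then a else lab (i %% n).
exists w; exists (fun i => st (i %% n)).
  split=> [|i]; first by rewrite mod0n.
  have -> : st (i.+1 %% n) = st (i %% n).+1.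
    rewrite -addn1 -modnDml addn1.
    have : (i %% n).+1 <= n by rewrite ltn_mod.
    rewrite leq_eqVlt => /orP[/eqP->|lt_n]; last by rewrite modn_small.
    by rewrite modnn st_n.
  rewrite /w; case: eqP => [->|_]; last by apply: labP; rewrite ltn_mod.
  exact: tr_xy.
apply/infinite_natP => m; exists (m * n); first by rewrite leq_pmulr.
rewrite /w modnMl /=; suff -> : st ((m * n).+1 %% n) = y by [].
(* A cycle of length 1 is a loop, where [y] is [x] itself. *)
rewrite -addn1 modnMDl; have [n1|n_neq1] := eqVneq n 1.
  rewrite n1 modnn; move: n1 last_s; rewrite /n /L /=.
  by case: (s) => //= _ ->.
by rewrite modn_small // ltn_neqAle eq_sym n_neq1.
Qed.

Lemma useful_statesP A q :
  (q \in useful_states A) <-> exists w, accepted_from A q w.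
Proof.
rewrite inE; split=> [/asboolP nul|[w acc]].
  by apply: contrapT => /forallNP.
by apply/asboolP => /(_ w).
Qed.

Lemma useful_connect A q r :
  connect (ba_step A) q r -> r \in useful_states A -> q \in useful_states A.
Proof.
move=> /connectP[s path_s ->]; elim: s q path_s => //= p s IH q.
move=> /andP[/existsP[a tr] path_s] useful_last.
have /useful_statesP[w acc] := IH p path_s useful_last.
apply/useful_statesP; exists (fun i => if i is j.+1 then w j else a).
exact: accepted_from_cons acc.
Qed.

(** By the convention the accepting transition stays in the SCC of [x], so it remains accepting in
    the component automaton and closes into a cycle there. Every state of the SCC leads to that
    cycle. *)
Lemma useful_acc_source A x a y :
  no_acc_between_sccs A -> (x, a, y) \in ba_acc A ->
  {in scc_of A x, forall r, r \in useful_states (acc_inside A (scc_of A x))}.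
Proof.
move=> conv acc r; rewrite inE => /andP[_ rx].
apply: (@useful_connect (acc_inside A _) _ x) => //.
have yC := acc_scc_of conv acc; apply/useful_statesP.
apply: (@accepted_from_cycle (acc_inside A _) x a y).
  by rewrite inE acc inE (subsetP (ba_acc_sub A)) //= mem_scc_of.
by move: yC; rewrite inE => /andP[].
Qed.

Lemma accepting_scc_of A x a y :
  no_acc_between_sccs A -> (x, a, y) \in ba_acc A ->
  accepting_scc A (scc_of A x).
Proof.
move=> conv acc; split; first exact: scc_of_is_scc.
apply/set0Pn; exists (x, a, y); have yC := acc_scc_of conv acc.
by rewrite inE acc inE (subsetP (ba_acc_sub A)) //= mem_scc_of.
Qed.

(** * Finite runs, the subset automaton and Koenig's lemma *)

Fixpoint reaches A (w : nat -> Sigma) n q k x : Prop :=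
  if k is k'.+1 then
    exists2 p, (q, w n, p) \in ba_trans A & reaches A w n.+1 p k' x
  else q = x.

Lemma reaches_rcons A w n q k x y :
  reaches A w n q k x -> (x, w (n + k), y) \in ba_trans A ->
  reaches A w n q k.+1 y.
Proof.
elim: k n q => [|k IH] n q /=; first by move=> ->; rewrite addn0; exists y.
by move=> [p tr rp] tr_xy; exists p => //; apply: IH => //; rewrite addSnnS.
Qed.

Lemma reaches_connect A w n q k x :
  reaches A w n q k x -> connect (ba_step A) q x.
Proof.
elim: k n q => [|k IH] n q /=; first by move=> ->; apply: connect0.
move=> [p tr /IH]; apply: connect_trans.
exact/connect1/(ba_step_trans tr).
Qed.

Lemma df_run_reaches A w i x :
  x \in df_run (subset_dfin A) w i ->
  exists2 q, q \in ba_init A & reaches A w 0 q i x.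
Proof.
elim: i x => [|i IH] x /=; first by exists x.
move=> /bigcupP[r /IH[q qI rch]]; rewrite inE => tr.
by exists q => //; apply: reaches_rcons rch _.
Qed.

Lemma run_df_run A w q rho i :
  q \in ba_init A -> is_run A w q rho ->
  rho i \in df_run (subset_dfin A) w i.
Proof.
move=> qI [rho0 rho_tr]; elim: i => [|i IH] /=; first by rewrite rho0.
by apply/bigcupP; exists (rho i) => //; rewrite inE.
Qed.

Definition hits A w x n q k : Prop :=
  reaches A w n q k x /\ exists y, (x, w (n + k), y) \in ba_acc A.

(** Koenig's lemma: among the finitely many successors of a state with infinitely many hits, one
    again has infinitely many. *)
Lemma hits_infinite_run A w x q :
  infinitely_often (hits A w x 0 q) ->
  exists2 rho, is_run A w q rho &
    forall n, infinitely_often (hits A w x n (rho n)).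
Proof.
move=> io0.
have step (s : nat * Q) : exists p, infinitely_often (hits A w x s.1 s.2) ->
    (s.2, w s.1, p) \in ba_trans A /\ infinitely_often (hits A w x s.1.+1 p).
  case: s => n r /=.
  have [io_r|?] := pselect (infinitely_often (hits A w x n r)); last by exists r.
  have /infinitely_often_pigeonhole[p io_p] : infinitely_often (fun k =>
      exists p, (r, w n, p) \in ba_trans A /\ hits A w x n.+1 p k).
    (* The bound [m.+1] excludes the empty path and leaves length at least [m] once the first
       transition is removed. *)
    move=> m; have [k'] := io_r m.+1.
    case: k' => // k lt_mk [/= [p tr rch] [y acc]].
    exists k => //; exists p; split=> //; split=> //.
    by exists y; rewrite addSnnS.
  exists p => _; split; first by have [? _ []] := io_p 0.
  by move=> m; have [k le_mk [_ hit]] := io_p m; exists k.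
have [nxt nxtP] := choice step.
pose rho := fix rho n := if n is m.+1 then nxt (m, rho m) else q.
have rho_io n : infinitely_often (hits A w x n (rho n)).
  by elim: n => [|n IH] //=; have [] := nxtP (n, rho n) IH.
by exists rho => //; split=> // i; have [] := nxtP (i, rho i) (rho_io i).
Qed.

End Components.

(** * Almost determinism makes the limit run accepting *)

Lemma infinite_hits_accepted (Sigma Q : finType) (A : buchi Sigma Q) w x q :
  no_acc_between_sccs A -> initial_almost_deterministic A (scc_of A x) ->
  infinitely_often (hits A w x 0 q) -> accepted_from A q w.
Proof.
move=> conv iad /hits_infinite_run[rho [rho0 rho_tr] rho_io].
exists rho; first by split.
set U := useful_states (acc_inside A (scc_of A x)).
have hits_useful n r k : hits A w x n r k -> r \in U.
  move=> [/reaches_connect rx [y acc]].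
  apply: (@useful_connect _ _ (acc_inside A _) _ x rx).
  exact: useful_acc_source acc _ (mem_scc_of A x).
have rhoU n : rho n \in U by have [k _ /hits_useful] := rho_io n 0.
(* Almost determinism concerns the SCCs of the restricted automaton, so the run is lifted to its
   state type. *)
pose sig r (rU : r \in U) : {r : Q | r \in U} := Sub r rU.
pose rho_sig n := sig (rho n) (rhoU n).
have [N backN] : exists N, forall n, N <= n ->
    connect (ba_step (component_ba A (scc_of A x))) (rho_sig n.+1) (rho_sig n).
  apply: eventually_connect_back => i; apply: (@ba_step_trans _ _ _ _ (w i)).
  by rewrite inE /=; apply: rho_tr.
(* From [N] on, [rho n] and [rho n.+1] share an SCC, which leaves only the equality case of almost
   determinism. *)
have uniq_succ n p : N <= n -> (rho n, w n, p) \in ba_trans A -> p \in U ->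
    p = rho n.+1.
  move=> le_Nn tr pU.
  have tr_p : (rho_sig n, w n, sig p pU)
      \in ba_trans (component_ba A (scc_of A x)) by rewrite inE.
  have tr_rho : (rho_sig n, w n, rho_sig n.+1)
      \in ba_trans (component_ba A (scc_of A x)) by rewrite inE; apply: rho_tr.
  have [/(congr1 val) //|[_ []]] := iad _ _ _ _ tr_p tr_rho.
  apply: connect_same_scc (backN _ le_Nn).
  exact/connect1/(ba_step_trans tr_rho).
(* All states on a path to a hit are useful, so the path cannot leave [rho]. *)
have uniq_hit k n : N <= n -> hits A w x n (rho n) k -> x = rho (n + k).
  elim: k n => [|k IH] n le_Nn [/= rch [y acc]]; first by rewrite addn0.
  case: rch => p tr rch; rewrite -addSnnS in acc *.
  have hit_p : hits A w x n.+1 p k by split=> //; exists y.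
  have pE := uniq_succ _ _ le_Nn tr (hits_useful _ _ _ hit_p).
  by apply: IH; [apply: leqW | rewrite -pE].
apply/infinite_natP => m.
have [k le_mk hit] := rho_io N m; exists (N + k).
  exact: leq_trans le_mk (leq_addl _ _).
have xE := uniq_hit _ _ (leqnn N) hit; case: hit => _ [y acc].
(* As [y] is useful too, it is the next state of [rho], which therefore takes the accepting
   transition. *)
have yU : y \in U by apply: useful_acc_source acc _ (acc_scc_of conv acc).
rewrite -(uniq_succ (N + k) y) -?xE //; first exact: leq_addr.
exact: (subsetP (ba_acc_sub A)).
Qed.

Theorem theorem1 (Sigma Q : finType) (A : buchi Sigma Q)
    (Sigma_nonempty : 0 < #|Sigma|)
    (acc_convention : no_acc_between_sccs A)
    (acc_iadac : forall C : {set Q}, accepting_scc A C -> iadac A C) :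
  ba_lang A = (~` df_lang (subset_dfin A))%classic.
Proof.
apply/seteqP; split=> w /=.
  move=> [q qI [rho run_rho /infinite_natP acc]].
  apply/infinite_natP => m; have [k le_mk acc_k] := acc m.
  exists k => //=; apply/set0Pn; exists (rho k.+1); apply/bigcupP.
  by exists (rho k); [apply: run_df_run run_rho | rewrite inE].
move=> /infinite_natP io_col.
(* Pairing the initial state with the accepting source lets one pigeonhole fix both. *)
have : infinitely_often (fun k => exists qx : Q * Q,
    qx.1 \in ba_init A /\ hits A w qx.2 0 qx.1 k).
  move=> m; have [k le_mk /set0Pn[y /bigcupP[x x_run]]] := io_col m.
  rewrite inE => acc; have [q qI rch] := df_run_reaches x_run.
  by exists k => //; exists (q, x); split=> //; split=> //; exists y.
move=> /infinitely_often_pigeonhole[[q x] /= io_qx].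
(* A single hit shows that [q] is initial and that the SCC of [x] is accepting. *)
have [k _ [qI [_ [y acc]]]] := io_qx 0; exists q => //.
apply: (infinite_hits_accepted (x := x)) => //.
  by have [] := acc_iadac _ (accepting_scc_of acc_convention acc).
by move=> m; have [j le_mj [_ hit]] := io_qx m; exists j.
Qed.
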